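(* For every $n\in\mathbb{Z}_{>0}$, let $\sigma^n$ be a (deterministic) permutation of size $n$. Then the following are equivalent: (i) the sequence $(\sigma^n)_{n\in\mathbb{Z}_{>0}}$ converges in the Benjamini--Schramm sense (that is, there exists a random possibly infinite rooted permutation to which it Benjamini--Schramm converges); (ii) there exist non-negative real numbers $(\Delta_\pi)_{\pi\in\mathcal{S}}$ such that for all patterns $\pi\in\mathcal{S}$, $\widetilde{\mathrm{c\text{-}occ}}(\pi,\sigma^n)\to\Delta_\pi$ as $n\to\infty$.
   Context: All intervals $[a,b]$ are integer intervals. $\mathcal{S}^n$ is the set of permutations $\sigma=\sigma_1\cdots\sigma_n$ of $[n]=\{1,\dots,n\}$, $|\sigma|=n$ is the size, and $\mathcal{S}=\bigcup_{n\ge1}\mathcal{S}^n$. For $I\subseteq[n]$, $\mathrm{pat}_I(\sigma)$ is the permutation of size $|I|$ in the same relative order as $(\sigma_i)_{i\in I}$. For $\pi\in\mathcal{S}$, $\mathrm{c\text{-}occ}(\pi,\sigma)$ is the number of intervals $I\subseteq[n]$ with $|I|=|\pi|$ and $\mathrm{pat}_I(\sigma)=\pi$, and $\widetilde{\mathrm{c\text{-}occ}}(\pi,\sigma)=\mathrm{c\text{-}occ}(\pi,\sigma)/n$ where $n=|\sigma|$. Rooted permutations. A finite rooted permutation is a pair $(\sigma,i)$ with $\sigma\in\mathcal{S}^n$, $i\in[n]$. It is identified with the pair $(A_{\sigma,i},\preccurlyeq_{\sigma,i})$, where $A_{\sigma,i}=[-i+1,|\sigma|-i]$ and $\preccurlyeq_{\sigma,i}$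 is the total order on it given by $\ell\preccurlyeq_{\sigma,i}j\iff\sigma_{\ell+i}\le\sigma_{j+i}$; this is a bijection between finite rooted permutations and total orders on finite integer intervals containing $0$. An infinite rooted permutation is a pair $(A,\preccurlyeq)$ with $A$ an infinite integer interval containing $0$ and $\preccurlyeq$ a total order on $A$. $\tilde{\mathcal{S}}_\bullet$ is the set of all finite and infinite rooted permutations. For $h\in\mathbb{Z}_{>0}$, $r_h(A,\preccurlyeq)=(A\cap[-h,h],\preccurlyeq)$. The local distance on $\tilde{\mathcal{S}}_\bullet$ is $d(x,y)=2^{-\sup\{h\in\mathbb{Z}_{>0}:\,r_h(x)=r_h(y)\}}$, with $\sup\emptyset=0$, $\sup\mathbb{Z}_{>0}=+\infty$, $2^{-\infty}=0$. Benjamini--Schramm convergence. A sequence $(\sigma^n)$ in $\mathcal{S}$ Benjamini--Schramm converges to a random element $(\boldsymbol{A},\boldsymbol{\preccurlyeq})$ of $\tilde{\mathcal{S}}_\bullet$ if, with $\boldsymbol{i}_n$ uniform in $[1,|\sigma^n|]$, the random rooted permutations $(\sigma^n,\boldsymbol{i}_n)$ converge in distribution to $(\boldsymbol{A},\boldsymbol{\preccurlyeq})$ with respect to $d$. *)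

(* Defs.v *)
From HB Require Import structures.
From mathcomp Require Import all_boot all_order all_fingroup all_algebra.
From mathcomp Require Import zify.
From mathcomp Require Import all_classical all_reals all_analysis.

Set Implicit Arguments.
Unset Strict Implicit.
Unset Printing Implicit Defensive.

Import Order.TTheory GRing.Theory Num.Theory.
Import numFieldNormedType.Exports.

Local Open Scope classical_set_scope.
Local Open Scope ring_scope.

(* A permutation of size n is an element of 'S_n, so positions and values are
   numbered from 0.  The positive sizes are the n.+1. *)

Section patterns.
Variables (n : nat) (I : {set 'I_n}) (sigma : 'S_n).
Local Open Scope nat_scope.

Definition value_at (j : 'I_#|I|) : 'I_n := sigma (enum_val j).

Definition values_below (j : 'I_#|I|) : {set 'I_n} :=
  [set i in I | sigma i < value_at j]%SET.

Lemma card_values_below j : #|values_below j| < #|I|.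
Proof.
apply: proper_card; apply/properP; split.
  by apply/fintype.subsetP => i; rewrite inE => /andP[].
by exists (enum_val j); rewrite ?enum_valP// inE ltnn andbF.
Qed.

Definition pat_fun (j : 'I_#|I|) : 'I_#|I| := Ordinal (card_values_below j).

Lemma pat_fun_lt j k : value_at j < value_at k -> pat_fun j < pat_fun k.
Proof.
move=> jk; apply: proper_card; apply/properP; split.
  apply/fintype.subsetP => i; rewrite !inE => /andP[-> ij] /=.
  exact: ltn_trans ij jk.
by exists (enum_val j); rewrite !inE enum_valP //= ltnn.
Qed.

Lemma pat_fun_inj : injective pat_fun.
Proof.
move=> j k jk; apply: enum_val_inj; apply: (@perm_inj _ sigma); apply: val_inj.
case: (ltngtP (value_at j) (value_at k)) => // /pat_fun_lt.
  by rewrite jk ltnn.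
by rewrite jk ltnn.
Qed.

Definition pat : 'S_#|I| := perm pat_fun_inj.

Lemma ltn_pat j k : (pat j < pat k) = (value_at j < value_at k).
Proof.
rewrite !permE; apply/idP/idP => [|/pat_fun_lt//].
case: (ltngtP (value_at j) (value_at k)) => // [/pat_fun_lt kj jk|].
  by have := ltn_trans jk kj; rewrite ltnn.
by move=> /val_inj/perm_inj/enum_val_inj ->; rewrite ltnn.
Qed.

End patterns.

Definition interval_set (n : nat) (I : {set 'I_n}) : bool :=
  [forall i in I, forall j in I, forall k : 'I_n,
    ((i <= k)%N && (k <= j)%N) ==> (k \in I)].

(* Permutations of possibly different sizes are compared as elements of
   {k : nat & 'S_k}, which makes #|I| = k part of pat I sigma = pi. *)
Definition c_occ (k n : nat) (pi : 'S_k) (sigma : 'S_n) : nat :=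
  #|[set I : {set 'I_n} | interval_set I &
      `[< existT (fun m : nat => 'S_m) #|I| (pat I sigma)
          = existT (fun m : nat => 'S_m) k pi >] ]%SET|.

Definition c_occ_prop (R : realType) (k n : nat) (pi : 'S_k) (sigma : 'S_n)
  : R := (c_occ pi sigma)%:R / n%:R.

(* The order is recorded as a relation on int that holds only between points
   of the domain, so that equality of records is equality of pairs
   (domain, order on the domain). *)
Record rooted_perm := RootedPerm {
  rdom : set int ;
  rle : int -> int -> Prop ;
  rdom0 : rdom 0 ;
  rdom_itv : is_interval rdom ;
  rle_dom : forall i j, rle i j -> rdom i /\ rdom j ;
  rle_refl : forall i, rdom i -> rle i i ;
  rle_anti : forall i j, rle i j -> rle j i -> i = j ;
  rle_trans : forall j i k, rle i j -> rle j k -> rle i k ;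
  rle_total : forall i j, rdom i -> rdom j -> rle i j \/ rle j i }.

Lemma rooted_permP (x y : rooted_perm) :
  rdom x = rdom y -> (forall i j, rle x i j <-> rle y i j) -> x = y.
Proof.
case: x y => [A le A0 Ai led r a t tt] [B le' B0 Bi led' r' a' t' tt'] /= AB leE.
have {leE}leE : le = le' by apply/funext => i; apply/funext => j; apply/propext.
move: AB leE A0 Ai led r a t tt => -> -> *.
by congr RootedPerm; exact: Prop_irrelevance.
Qed.

Section finite_rooted.
Variables (n : nat) (sigma : 'S_n) (i : 'I_n).

(* With positions numbered from 0, [-i+1, n-i] becomes [-i, n-i-1]. *)
Definition finite_dom : set int :=
  [set l : int | - i%:Z <= l <= n%:Z - i%:Z - 1].

Definition finite_le (l j : int) : Prop :=
  exists a b : 'I_n,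
    [/\ a%:Z = l + i%:Z, b%:Z = j + i%:Z & (sigma a <= sigma b)%N].

Lemma finite_domP l : finite_dom l <-> exists a : 'I_n, a%:Z = l + i%:Z.
Proof.
split=> [/andP[l1 l2]|[[a an] /= al]]; last first.
  by rewrite /finite_dom /=; lia.
have ln : (absz (l + i%:Z)%R < n)%N by have := ltn_ord i; lia.
by exists (Ordinal ln) => /=; lia.
Qed.

Lemma finite_dom0 : finite_dom 0.
Proof. by apply/finite_domP; exists i; rewrite add0r. Qed.

Lemma finite_dom_itv : is_interval finite_dom.
Proof. by move=> x y; rewrite /finite_dom /= => ? ? z; lia. Qed.

Lemma finite_le_dom l j : finite_le l j -> finite_dom l /\ finite_dom j.
Proof.
by move=> [a [b [al bj _]]]; split; apply/finite_domP; [exists a|exists b].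
Qed.

Lemma finite_le_refl l : finite_dom l -> finite_le l l.
Proof. by move=> /finite_domP[a al]; exists a, a. Qed.

Lemma finite_le_anti l j : finite_le l j -> finite_le j l -> l = j.
Proof.
move=> [a [b [al bj ab]]] [b' [a' [b'j a'l b'a']]].
have aa' : a = a' by apply: val_inj; apply/eqP; rewrite /= -eqz_nat al a'l.
have bb' : b = b' by apply: val_inj; apply/eqP; rewrite /= -eqz_nat bj b'j.
subst a' b'; apply: (addIr i%:Z); rewrite -al -bj.
by congr (Posz (val _)); apply: (@perm_inj _ sigma); apply: val_inj;
  apply/eqP; rewrite /= eqn_leq ab.
Qed.

Lemma finite_le_trans j l m : finite_le l j -> finite_le j m -> finite_le l m.
Proof.
move=> [a [b [al bj ab]]] [b' [c [b'j cm b'c]]].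
have bb' : b = b' by apply: val_inj; apply/eqP; rewrite /= -eqz_nat bj b'j.
by subst b'; exists a, c; split=> //; apply: leq_trans b'c.
Qed.

Lemma finite_le_total l j :
  finite_dom l -> finite_dom j -> finite_le l j \/ finite_le j l.
Proof.
move=> /finite_domP[a al] /finite_domP[b bj].
case/orP: (leq_total (sigma a) (sigma b)) => ab; [left|right].
  by exists a, b.
by exists b, a.
Qed.

Definition finite_rooted : rooted_perm :=
  RootedPerm finite_dom0 finite_dom_itv finite_le_dom finite_le_refl
    finite_le_anti finite_le_trans finite_le_total.

End finite_rooted.

Section restriction.
Variables (h : nat) (x : rooted_perm).

Definition restr_dom : set int := rdom x `&` [set l : int | - h%:Z <= l <= h%:Z].

Definition restr_le (l j : int) : Prop :=
  [/\ rle x l j, restr_dom l & restr_dom j].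

Lemma restr_dom0 : restr_dom 0.
Proof. by split; [exact: rdom0|rewrite /=; lia]. Qed.

Lemma restr_dom_itv : is_interval restr_dom.
Proof.
move=> l j [xl /= lh] [xj /= jh] k lkj; split; first exact: (rdom_itv xl xj).
by rewrite /=; lia.
Qed.

Lemma restr_le_dom l j : restr_le l j -> restr_dom l /\ restr_dom j.
Proof. by case. Qed.

Lemma restr_le_refl l : restr_dom l -> restr_le l l.
Proof. by move=> xl; split=> //; apply: rle_refl; case: xl. Qed.

Lemma restr_le_anti l j : restr_le l j -> restr_le j l -> l = j.
Proof. by move=> [lj _ _] [jl _ _]; exact: rle_anti lj jl. Qed.

Lemma restr_le_trans j l m : restr_le l j -> restr_le j m -> restr_le l m.
Proof. by move=> [lj xl _] [jm _ xm]; split=> //; exact: rle_trans lj jm. Qed.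

Lemma restr_le_total l j :
  restr_dom l -> restr_dom j -> restr_le l j \/ restr_le j l.
Proof.
move=> xl xj; case: (rle_total (proj1 xl) (proj1 xj)) => ?; [left|right];
  by split.
Qed.

Definition restr : rooted_perm :=
  RootedPerm restr_dom0 restr_dom_itv restr_le_dom restr_le_refl
    restr_le_anti restr_le_trans restr_le_total.

End restriction.

Section local_distance.
Variable R : realType.
Implicit Types x y z : rooted_perm.

(* Adding 0 to the set makes its supremum 0 when no h > 0 qualifies. *)
Definition agreement x y : \bar R :=
  ereal_sup ([set 0%E] `|`
    [set (h%:R)%:E | h in [set h : nat | (0 < h)%N /\ restr h x = restr h y]]).

(* 2^{-s}, with 2^{-oo} = 0; s is nonnegative, so the value at -oo is unused. *)
Definition local_dist x y : R :=
  match agreement x y with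
  | s%:E => 2 `^ (- s)
  | _ => 0
  end.

Lemma agreement_ge0 x y : (0 <= agreement x y)%E.
Proof. by apply: ereal_sup_ubound; left. Qed.

Lemma restr_restr h k x : (h <= k)%N -> restr h (restr k x) = restr h x.
Proof.
move=> hk.
have domE l : restr_dom h (restr k x) l <-> restr_dom h x l.
  by split=> [[[? ?] ?]//|[? /= ?]]; split=> //; split=> //=; lia.
have domW l : restr_dom h x l -> restr_dom k x l.
  by move=> [? /= ?]; split=> //=; lia.
apply: rooted_permP => [|l j]; first by apply/seteqP; split=> l /domE.
split=> [[[lj _ _] /domE hl /domE hj]//|[lj hl hj]].
by split; [split=> //; exact: domW|exact/domE|exact/domE].
Qed.

Lemma restr_eq_le h k x y :
  (h <= k)%N -> restr k x = restr k y -> restr h x = restr h y.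
Proof. by move=> hk xy; rewrite -(restr_restr x hk) xy restr_restr. Qed.

Lemma restr0_eq x y : restr 0 x = restr 0 y.
Proof.
have H z l : restr_dom 0 z l <-> l = 0.
  split=> [[_ /= l0]|->]; [lia|exact: restr_dom0].
apply: rooted_permP => /= [|l j].
  by apply/seteqP; split=> l /H ->; apply/H.
by split=> -[_ /H -> /H ->]; apply: restr_le_refl; apply/H.
Qed.

Lemma restr_all_eq x y : (forall h, restr h x = restr h y) -> x = y.
Proof.
move=> xy; apply: rooted_permP => [|l j].
  apply/seteqP; split=> l xl.
    have : restr_dom `|l| x l by split=> //=; lia.
    by have /(congr1 rdom)/= -> := xy `|l|%N; case.
  have : restr_dom `|l| y l by split=> //=; lia.
  by have /(congr1 rdom)/= <- := xy `|l|%N; case.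
have xyE h : restr_le h x = restr_le h y by have /(congr1 rle) := xy h.
have wd z : rle z l j <-> restr_le (`|l| + `|j|) z l j.
  split=> [lj|[]//]; have [zl zj] := rle_dom lj.
  by split=> //; split=> //=; lia.
by split=> /wd xy'; apply/wd; [rewrite -xyE|rewrite xyE].
Qed.

Lemma agreement_ge h x y :
  ((h%:R)%:E <= agreement x y)%E <-> restr h x = restr h y.
Proof.
split=> [|xy]; last first.
  case: h xy => [_|h xy]; first exact: agreement_ge0.
  by apply: ereal_sup_ubound; right; exists h.+1.
move=> hs; apply: contrapT => nxy.
case: h => [|h] in hs nxy *; first by apply: nxy; exact: restr0_eq.
have : (agreement x y <= (h%:R)%:E)%E.
  apply: ge_ereal_sup => _ [->|[k [k0 kxy] <-]]; first by rewrite lee_fin.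
  rewrite lee_fin ler_nat leqNgt; apply/negP => hk.
  by apply: nxy; exact: restr_eq_le hk kxy.
by move=> /(le_trans hs); rewrite lee_fin ler_nat ltnn.
Qed.

(* The supremum defining the distance is +oo or is attained. *)
Lemma agreementP x y : agreement x y = +oo%E \/
  exists h : nat, agreement x y = (h%:R)%:E.
Proof.
have [all|] := pselect (forall h, restr h x = restr h y).
  left; apply/eqyP => r r0.
  apply: (@le_trans _ _ (((Num.truncn r).+1)%:R)%:E); last exact/agreement_ge.
  by rewrite lee_fin ltW// truncnS_gt.
move=> /existsNP[k kxy]; right.
have ex : exists h, `[< restr h x <> restr h y >] by exists k; exact/asboolP.
case: (ex_minnP ex) => -[|m] /asboolP mxy mmin.
  by case: mxy; exact: restr0_eq.
exists m; apply/eqP; rewrite eq_le; apply/andP; split.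
  apply: ge_ereal_sup => _ [->|[l [l0 lxy] <-]]; first by rewrite lee_fin.
  rewrite lee_fin ler_nat leqNgt; apply/negP => ml.
  by apply: mxy; exact: restr_eq_le ml lxy.
apply/agreement_ge; apply: contrapT => mxy'.
by have := mmin m (asboolT mxy'); rewrite ltnn.
Qed.

Lemma local_dist_ge0 x y : 0 <= local_dist x y.
Proof. by rewrite /local_dist; case: agreement => // r; exact: powR_ge0. Qed.

Lemma local_dist_le h x y :
  local_dist x y <= 2 ^- h <-> restr h x = restr h y.
Proof.
rewrite -agreement_ge /local_dist.
case: (agreementP x y) => [->|[m ->]].
  by rewrite leey; split=> // _; rewrite invr_ge0 exprn_ge0.
rewrite powRN powR_mulrn// lee_fin ler_nat lef_pV2 ?posrE ?exprn_gt0//.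
by rewrite ler_eXn2l// ltr1n.
Qed.

Lemma local_distxx x : local_dist x x = 0.
Proof.
rewrite /local_dist; case: (agreementP x x) => [->//|[m mE]].
have /agreement_ge : restr m.+1 x = restr m.+1 x by [].
by rewrite mE lee_fin ler_nat ltnn.
Qed.

Lemma local_dist_eq0 x y : local_dist x y = 0 -> x = y.
Proof.
move=> xy0; apply: restr_all_eq => h; apply/local_dist_le.
by rewrite xy0 invr_ge0 exprn_ge0.
Qed.

Lemma local_dist_sym x y : local_dist x y = local_dist y x.
Proof.
rewrite /local_dist; suff -> : agreement x y = agreement y x by [].
rewrite /agreement; congr (ereal_sup (_ `|` _)).
by apply/seteqP; split=> _ [h [h0 hxy] <-]; exists h.
Qed.

Lemma local_distP x y : local_dist x y = 0 \/
  exists h : nat, local_dist x y = 2 ^- h.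
Proof.
rewrite /local_dist; case: (agreementP x y) => [->|[m ->]]; first by left.
by right; exists m; rewrite powRN powR_mulrn.
Qed.

Lemma local_dist_ultra y x z :
  local_dist x z <= Num.max (local_dist x y) (local_dist y z).
Proof.
have ultra h : local_dist x y <= 2 ^- h -> local_dist y z <= 2 ^- h ->
    local_dist x z <= 2 ^- h.
  by move=> /local_dist_le xy /local_dist_le yz; apply/local_dist_le; rewrite xy.
case: (local_distP x y) => [/local_dist_eq0->|[h xyh]].
  by rewrite le_max lexx orbT.
case: (local_distP y z) => [/local_dist_eq0<-|[k yzk]].
  by rewrite le_max lexx.
rewrite le_max; case: (leP (local_dist x y) (local_dist y z)) => [xyz|/ltW xyz].
  by apply/orP; right; rewrite yzk; apply: ultra; rewrite -yzk.
by apply/orP; left; rewrite xyh; apply: ultra; rewrite -xyh.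
Qed.

Lemma local_dist_triangle y x z :
  local_dist x z <= local_dist x y + local_dist y z.
Proof.
apply: le_trans (local_dist_ultra y x z) _.
by rewrite ge_max lerDl lerDr !local_dist_ge0.
Qed.

End local_distance.

(* The type argument R only serves to attach the R-valued distance. *)
Definition local_space (R : realType) : Type := rooted_perm.

HB.instance Definition _ (R : realType) := gen_eqMixin (local_space R).
HB.instance Definition _ (R : realType) := gen_choiceMixin (local_space R).
HB.instance Definition _ (R : realType) :=
  isPointed.Build (local_space R) (finite_rooted 1%g (ord0 : 'I_1)).
HB.instance Definition _ (R : realType) :=
  @isMetric.Build R (local_space R) (@local_dist R) (@local_distxx R)
    (@local_dist_eq0 R) (@local_dist_sym R) (@local_dist_triangle R).

Definition borel (T : ptopologicalType) := g_sigma_algebraType (@open T).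

Section uniform_root.
Variables (R : realType) (n : nat).

HB.instance Definition _ := isPointed.Build 'I_n.+1 ord0.
HB.instance Definition _ := @isMeasurable.Build default_measure_display
  'I_n.+1 discrete_measurable discrete_measurable0
  discrete_measurableC discrete_measurableU.

Definition uniform_ord : set 'I_n.+1 -> \bar R :=
  mscale (n.+1%:R^-1)%:nng (@counting 'I_n.+1 R).

HB.instance Definition _ := Measure.on uniform_ord.

Lemma uniform_ord_setT : uniform_ord setT = 1%E.
Proof.
have cardT : ([set: 'I_n.+1] #= `I_n.+1)%card.
  rewrite (_ : `I_n.+1 = range (@nat_of_ord n.+1)).
    by rewrite card_eq_sym; apply: inj_card_eq => x y _ _; exact: val_inj.
  by apply/seteqP; split=> [k kn|_ [i _ <-]] /=; [exists (Ordinal kn)|].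
rewrite /uniform_ord /mscale /= /counting asboolT; last by exists n.+1.
by rewrite (card_fset_set cardT) -EFinM mulVf.
Qed.

HB.instance Definition _ :=
  @Measure_isProbability.Build _ _ R uniform_ord uniform_ord_setT.

Variable sigma : 'S_n.+1.

Definition rooted_at (i : 'I_n.+1) : borel (local_space R) :=
  finite_rooted sigma i.

Lemma measurable_rooted_at : measurable_fun setT rooted_at.
Proof. by []. Qed.

HB.instance Definition _ := isMeasurableFun.Build _ _ _ _ rooted_at
  measurable_rooted_at.

End uniform_root.
Arguments uniform_ord : clear implicits.

Definition cvg_in_distribution (R : realType) (T : ptopologicalType)
    (d_ : nat -> measure_display) (Omega_ : forall n, measurableType (d_ n))
    (P_ : forall n, probability (Omega_ n) R)
    (X_ : forall n, {RV (P_ n) >-> borel T})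
    (d : measure_display) (Omega : measurableType d) (P : probability Omega R)
    (X : {RV P >-> borel T}) : Prop :=
  forall f : T -> R, continuous f -> bounded_fun f ->
    ('E_(P_ n)[f \o X_ n] @[n --> \oo] --> 'E_P[f \o X])%E.

Definition BS_converges_to (R : realType) (size_ : nat -> nat)
    (sigma_ : forall n, 'S_(size_ n).+1)
    (d : measure_display) (Omega : measurableType d) (P : probability Omega R)
    (X : {RV P >-> borel (local_space R)}) : Prop :=
  cvg_in_distribution
    (P_ := fun n => uniform_ord R (size_ n))
    (fun n => rooted_at R (sigma_ n)) X.

Definition BS_converges (R : realType) (size_ : nat -> nat)
    (sigma_ : forall n, 'S_(size_ n).+1) : Prop :=
  exists (d : measure_display) (Omega : measurableType d)
    (P : probability Omega R) (X : {RV P >-> borel (local_space R)}),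
    BS_converges_to sigma_ X.

(* Main.v *)
Require Import Defs.
From HB Require Import structures.
From mathcomp Require Import all_boot all_order all_fingroup all_algebra.
From mathcomp Require Import zify lra.
From mathcomp Require Import all_classical all_reals all_analysis.
From mathcomp Require Import measurable_realfun.

Set Implicit Arguments.
Unset Strict Implicit.
Unset Printing Implicit Defensive.

Import Order.TTheory GRing.Theory Num.Theory.
Import numFieldNormedType.Exports.

Local Open Scope classical_set_scope.
Local Open Scope ring_scope.

(* The event that a window containing the root carries a given pattern depends
   on a bounded neighbourhood of the root, hence is clopen, and its probability
   under a uniform root is the density of that pattern; so convergence in law
   gives convergence of all pattern densities.

   Conversely, up to the O(1/n) proportion of roots close to an end, the
   h-neighbourhood of a uniform root is the pattern of a window of size 2h+1, so
   the probability of every cylinder (a set determined by some h-neighbourhood)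
   converges.  The space is compact: the limit order along an ultrafilter is
   obtained by letting i <= j hold when it holds almost everywhere.  Hence the
   limits form a premeasure on the algebra of cylinders, which Caratheodory's
   theorem extends to a Borel probability.  Continuous functions are uniformly
   approximated by functions of the h-neighbourhood, hence the expectations
   converge. *)

(** * Permutations and intervals *)

Lemma card_ord_lt m v : (v <= m)%N -> #|[set c : 'I_m | (c < v)%N]%SET| = v.
Proof.
move=> vm; rewrite cardsE -sum1_card.
by rewrite (big_ord_narrow vm) sum1_card card_ord.
Qed.

(** The value [p a] is the number of [b] with [p b < p a], so the order alone recovers the
    permutation. *)
Lemma perm_eq_lt m (p q : 'S_m) :
  (forall a b, (p a < p b) = (q a < q b))%N -> p = q.
Proof.
have cardp (r : 'S_m) a : #|[set b | (r b < r a)%N]%SET| = r a.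
  rewrite -[RHS](@card_ord_lt m) ?(ltnW (ltn_ord _))//.
  rewrite -[RHS](card_preimset _ (@perm_inj _ r)).
  by apply: eq_card => b; rewrite !inE.
move=> pq; apply/permP => a; apply: val_inj.
rewrite -[LHS](cardp p) -[RHS](cardp q).
by apply: eq_card => b; rewrite !inE pq.
Qed.

Lemma sized_perm_eqP m k (p : 'S_m) (q : 'S_k) :
  existT (fun m : nat => 'S_m) m p = existT (fun m : nat => 'S_m) k q <->
  exists e : m = k, forall a b,
    (p a <= p b)%N = (q (cast_ord e a) <= q (cast_ord e b))%N.
Proof.
split=> [|[e]].
  (* Stated for arbitrary pairs, the equation can be eliminated by rewriting, after which the cast
     is the identity. *)
  have H (u v : {k & 'S_k}) : u = v -> exists e : tag u = tag v, forall a b,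
      (tagged u a <= tagged u b)%N =
      (tagged v (cast_ord e a) <= tagged v (cast_ord e b))%N.
    by move=> ->; exists erefl => a b; rewrite !cast_ord_id.
  exact: H.
case: k / e q => q pq; congr existT; apply: perm_eq_lt => a b.
by rewrite !ltnNge pq !cast_ord_id.
Qed.

(** By value, [enum I] is a filter of [iota 0 n]. This splits into the parts before, inside and
    after the window, and the filter keeps exactly the middle one. *)
Lemma enum_interval n (I : {set 'I_n}) m k : (m + k <= n)%N ->
  (forall j : 'I_n, (j \in I) = (m <= j < m + k)%N) ->
  [seq val j | j <- enum I] = iota m k.
Proof.
move=> mkn IE; rewrite [in LHS]/enum_mem -enumT.
rewrite (@eq_filter _ _ (fun j => val j \in iota m k)); last first.
  by move=> j; rewrite mem_iota -IE.
rewrite -filter_map val_enum_ord.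
have -> : n = (m + (k + (n - (m + k))))%N by lia.
rewrite iotaD iotaD !filter_cat add0n.
rewrite (@eq_in_filter _ _ pred0 (iota 0 m)); last first.
  move=> j; rewrite mem_iota => jm; apply/negbTE.
  by change (j \notin iota m k); rewrite mem_iota; lia.
rewrite filter_pred0 /= (@eq_in_filter _ _ predT (iota m k)); last first.
  by move=> j jm; exact: jm.
rewrite filter_predT (@eq_in_filter _ _ pred0).
  by rewrite filter_pred0 cats0.
move=> j; rewrite mem_iota => jm; apply/negbTE.
by change (j \notin iota m k); rewrite mem_iota; lia.
Qed.

Lemma card_interval n (I : {set 'I_n}) m k : (m + k <= n)%N ->
  (forall j : 'I_n, (j \in I) = (m <= j < m + k)%N) -> #|I| = k.
Proof.
move=> mkn IE; rewrite cardE -(size_map val).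
by rewrite (enum_interval mkn IE) size_iota.
Qed.

Lemma enum_val_interval n (I : {set 'I_n}) m k : (m + k <= n)%N ->
  (forall j : 'I_n, (j \in I) = (m <= j < m + k)%N) ->
  forall a : 'I_#|I|, enum_val a = (m + a)%N :> nat.
Proof.
move=> mkn IE a; have ak : (a < k)%N by rewrite -(card_interval mkn IE).
rewrite (enum_val_nth (enum_val a)) -(nth_map _ 0%N val) -?cardE ?ltn_ord//.
by rewrite (enum_interval mkn IE) nth_iota.
Qed.

(** The least and greatest elements [p] and [q] delimit a convex set; its cardinality then forces
    [q - p = k]. *)
Lemma interval_setP n (I : {set 'I_n}) k :
  interval_set I -> #|I| = k.+1 -> exists m,
  (m + k.+1 <= n)%N /\ forall j : 'I_n, (j \in I) = (m <= j < m + k.+1)%N.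
Proof.
move=> Iitv Ik; have [i0 i0I] : exists i, i \in I.
  by apply/set0Pn; rewrite -card_gt0 Ik.
case: (arg_minnP (fun i : 'I_n => i : nat) i0I) => p pI pmin.
case: (arg_maxnP (fun i : 'I_n => i : nat) i0I) => q qI qmax.
have pq : (p <= q)%N := pmin _ qI.
have IE (j : 'I_n) : (j \in I) = (p <= j < p + (q - p).+1)%N.
  apply/idP/idP => [jI|jpq].
    by have := pmin _ jI; have /= := qmax _ jI; lia.
  move/'forall_implyP: Iitv => /(_ _ pI)/'forall_implyP/(_ _ qI)/forallP/(_ j).
  by move/implyP; apply; lia.
have pqn : (p + (q - p).+1 <= n)%N by have := ltn_ord q; lia.
have := card_interval pqn IE; rewrite Ik => -[kE].
by exists p; rewrite kE.
Qed.

(** * Consecutive occurrences seen from a root *)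

(* [s] is the position of the root in the window. *)
Definition occurs_at k (pi : 'S_k.+1) (s : nat) (x : rooted_perm) : Prop :=
  forall a b : 'I_k.+1,
    rle x (a%:Z - s%:Z) (b%:Z - s%:Z) <-> (pi a <= pi b)%N.

(** Positions enter through equations on their values, so that the statement needs no proof of
    [m + a < n]. *)
Definition occurs_from k n (pi : 'S_k.+1) (sigma : 'S_n) (m : nat) : Prop :=
  (m + k.+1 <= n)%N /\ forall (a b : 'I_k.+1) (a' b' : 'I_n),
    a' = (m + a)%N :> nat -> b' = (m + b)%N :> nat ->
    (sigma a' <= sigma b')%N = (pi a <= pi b)%N.

Lemma occurs_at_finite k n (pi : 'S_k.+1) (sigma : 'S_n) s (i : 'I_n) :
  (s <= k)%N -> occurs_at pi s (finite_rooted sigma i) <->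
  exists2 m, occurs_from pi sigma m & i = (m + s)%N :> nat.
Proof.
move=> sk; split=> [occ|[m [mkn occ] im] a b].
  (* The order holds only between points of the domain, so reflexivity at the two ends of the window
     gives [s <= i] and [i - s + k < n]. *)
  have [_ /(_ (leqnn _))] := occ ord0 ord0.
  move=> [x [_ [/= xE _ _]]].
  have [_ /(_ (leqnn _))] := occ ord_max ord_max.
  move=> [y [_ [/= yE _ _]]].
  have yn := ltn_ord y.
  exists (i - s)%N; last by lia.
  split=> [|a b a' b' a'E b'E]; first by lia.
  apply/idP/idP => ab.
    by apply/occ; exists a', b'; split=> //; lia.
  have /occ[a1 [b1 [a1E b1E]]] := ab.
  have -> : a1 = a' by apply: val_inj => /=; lia.
  by have -> : b1 = b' by apply: val_inj => /=; lia.
have ltn_m (c : 'I_k.+1) : (m + c < n)%N by have := ltn_ord c; lia.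
rewrite -(occ a b (Ordinal (ltn_m a)) (Ordinal (ltn_m b)))//.
split=> [[a' [b' [a'E b'E]]]|ab]; last first.
  by exists (Ordinal (ltn_m a)), (Ordinal (ltn_m b)); split=> //=; lia.
have -> : a' = Ordinal (ltn_m a) by apply: val_inj => /=; lia.
by have -> : b' = Ordinal (ltn_m b) by apply: val_inj => /=; lia.
Qed.

Lemma leq_pat n (I : {set 'I_n}) (sigma : 'S_n) j k :
  (pat I sigma j <= pat I sigma k)%N =
  (value_at sigma j <= value_at sigma k)%N.
Proof. by rewrite leqNgt ltn_pat -leqNgt. Qed.

(** On an interval [enum_val] is translation by [m], so [pat] compares exactly the values of [sigma]
    in the window. *)
Lemma pat_intervalP k n (pi : 'S_k.+1) (sigma : 'S_n) (I : {set 'I_n}) m :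
  (m + k.+1 <= n)%N ->
  (forall j : 'I_n, (j \in I) = (m <= j < m + k.+1)%N) ->
  existT (fun m : nat => 'S_m) #|I| (pat I sigma)
    = existT (fun m : nat => 'S_m) k.+1 pi <-> occurs_from pi sigma m.
Proof.
move=> mkn IE; have Ik := card_interval mkn IE.
have EV := enum_val_interval mkn IE.
rewrite sized_perm_eqP; split=> [[e H]|[_ H]].
  split=> // a b a' b' a'E b'E.
  have := H (cast_ord (esym e) a) (cast_ord (esym e) b).
  rewrite !cast_ordKV => <-; rewrite leq_pat /value_at.
  have -> : enum_val (cast_ord (esym e) a) = a'.
    by apply: val_inj; rewrite /= EV a'E.
  have -> // : enum_val (cast_ord (esym e) b) = b'.
  by apply: val_inj; rewrite /= EV b'E.
exists Ik => a b; rewrite leq_pat /value_at.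
by apply: H; rewrite EV.
Qed.

(** For a fixed offset [s], sending a root to its window is a bijection from the roots seeing [pi]
    to the occurrences of [pi]. *)
Lemma c_occE k n (pi : 'S_k.+1) (sigma : 'S_n) s : (s <= k)%N ->
  c_occ pi sigma =
  #|[set i : 'I_n | `[< occurs_at pi s (finite_rooted sigma i) >]]%SET|.
Proof.
move=> sk.
(* This is the interval from [i - s] to [i - s + k], written additively to avoid truncated
   subtraction. *)
pose window (i : 'I_n) := [set j : 'I_n | (i <= j + s <= i + k)%N]%SET.
have windowE (i j : 'I_n) m : i = (m + s)%N :> nat ->
    (j \in window i) = (m <= j < m + k.+1)%N by rewrite inE; lia.
rewrite /c_occ -(@card_in_imset _ _ window) => [|i j]; last first.
  rewrite !inE => /(occurs_at_finite _ _ _ sk)[m [mkn _] im].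
  move=> /(occurs_at_finite _ _ _ sk)[m' [m'kn _] jm'] /setP ij.
  have mn : (m < n)%N by lia.
  have m'n : (m' < n)%N by lia.
  (* Each window contains the starting point of the other, which gives [m <= m'] and [m' <= m]. *)
  have := ij (Ordinal mn); have := ij (Ordinal m'n).
  rewrite !(windowE _ _ _ im) !(windowE _ _ _ jm') /= => m'1 m1.
  by apply: val_inj => /=; lia.
apply: eq_card => I; rewrite inE; apply/andP/imsetP => [[Iitv /asboolP IE]|].
  have [m [mkn Im]] := interval_setP Iitv (congr1 (@projT1 _ _) IE).
  have msn : (m + s < n)%N by lia.
  exists (Ordinal msn).
    rewrite inE; apply/asboolP/occurs_at_finite => //.
    by exists m => //; apply/(pat_intervalP _ _ mkn Im).
  by apply/setP => j; rewrite Im (@windowE _ _ m).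
move=> [i]; rewrite inE => /asboolP/(occurs_at_finite _ _ _ sk)[m occ im] ->.
have mkn := occ.1.
split; last first.
  apply/asboolP/(pat_intervalP _ _ mkn _) => // j.
  exact: windowE.
apply/'forall_implyP => a; rewrite (windowE _ _ _ im) => am.
apply/'forall_implyP => b; rewrite (windowE _ _ _ im) => bm.
by apply/forallP => c; apply/implyP; rewrite (windowE _ _ _ im); lia.
Qed.

(** * The local topology *)

(** The truth table of the order on [-h, h]; its diagonal records the domain. Its values form a
    finite type, so the classes of agreement up to [h] are finite in number. *)
Definition code (h : nat) (x : rooted_perm) :
    {ffun 'I_h.*2.+1 * 'I_h.*2.+1 -> bool} :=
  [ffun p : 'I_h.*2.+1 * 'I_h.*2.+1 =>
    `[< rle x (p.1%:Z - h%:Z) (p.2%:Z - h%:Z) >]].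

Lemma rle_rdom x i : rle x i i <-> rdom x i.
Proof. by split=> [/rle_dom[]|/rle_refl]. Qed.

Lemma rle_restr h x i j : - h%:Z <= i <= h%:Z -> - h%:Z <= j <= h%:Z ->
  rle x i j <-> rle (restr h x) i j.
Proof. by move=> ih jh; split=> [ij|[]//]; have [] := rle_dom ij. Qed.

Lemma codeP h x y : code h x = code h y <-> restr h x = restr h y.
Proof.
split=> [/ffunP xy|xy]; last first.
  have ordh (a : 'I_h.*2.+1) : - h%:Z <= a%:Z - h%:Z <= h%:Z.
    by have := ltn_ord a; lia.
  apply/ffunP => -[a b]; rewrite !ffunE /=; apply: asbool_equiv_eq.
  by rewrite (rle_restr x (ordh a) (ordh b)) xy -rle_restr.
have rleE i j : - h%:Z <= i <= h%:Z -> - h%:Z <= j <= h%:Z ->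
    rle x i j <-> rle y i j.
  move=> ih jh.
  have ih' : (absz (i + h%:Z)%R < h.*2.+1)%N by lia.
  have jh' : (absz (j + h%:Z)%R < h.*2.+1)%N by lia.
  have := xy (Ordinal ih', Ordinal jh'); rewrite !ffunE /=.
  rewrite (_ : _ - _ = i); last by lia.
  rewrite (_ : _ - _ = j); last by lia.
  exact: asbool_eq_equiv.
have domE i : restr_dom h x i <-> restr_dom h y i.
  by split=> -[+ ih]; rewrite -rle_rdom => zi; split=> //;
    apply/rle_rdom/(rleE _ _ ih ih).
apply: rooted_permP => /= [|i j]; first by apply/seteqP; split=> i /domE.
split=> -[ij ix jx]; split; [|exact/domE|exact/domE| |exact/domE|exact/domE].
  exact/(rleE _ _ ix.2 jx.2).
exact/(rleE _ _ ix.2 jx.2).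
Qed.

Section topology.
Variable R : realType.
Local Notation S := (local_space R).

(** The closed ball of radius [2 ^- h] is the class of agreement up to [h], and these radii tend to
    0. *)
Lemma nbhs_localP (x : S) (A : set S) :
  nbhs x A <-> exists h, forall y : S, restr h x = restr h y -> A y.
Proof.
split=> [/nbhs_ballP[e /= e0 eA]|[h hA]].
  have [h he] : exists h, 2 ^- h < e :> R.
    have [N _ /(_ N (leqnn _))] := near_infty_natSinv_expn_lt (PosNum e0).
    by rewrite /= div1r; exists N.
  exists h => y xy; apply: eA; rewrite ballEmdist /=.
  by apply: le_lt_trans he; exact/local_dist_le.
apply/nbhs_ballP; exists (2 ^- h) => /=; first by rewrite invr_gt0 exprn_gt0.
move=> y; rewrite ballEmdist /= => /ltW xy.
by apply: hA; apply/(local_dist_le R).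
Qed.

Section ultralimit.
Variables (F : set_system rooted_perm) (FF : UltraFilter F).

Let dom : set int := [set i | F [set x | rdom x i]].
Let le (i j : int) : Prop := F [set x | rle x i j].

Let dom0 : dom 0.
Proof. by apply: filterS filterT => x _; exact: rdom0. Qed.

Let dom_itv : is_interval dom.
Proof.
move=> i j Fi Fj k ikj; apply: filterS2 Fi Fj => x xi xj.
exact: rdom_itv ikj.
Qed.

Let le_dom i j : le i j -> dom i /\ dom j.
Proof. by split; apply: filterS H => x /rle_dom[]. Qed.

Let le_refl i : dom i -> le i i.
Proof. by apply: filterS => x; exact: rle_refl. Qed.

Let le_anti i j : le i j -> le j i -> i = j.
Proof.
by move=> ij ji; have [x [/= xij xji]] := filter_ex (filterI ij ji);
  exact: rle_anti xij xji.
Qed.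

Let le_trans j i k : le i j -> le j k -> le i k.
Proof. by apply: filterS2 => x; exact: rle_trans. Qed.

(** Totality is where maximality of [F] enters: one of two complementary sets belongs to [F]. *)
Let le_total i j : dom i -> dom j -> le i j \/ le j i.
Proof.
move=> Fi Fj; have [ij|nij] := in_ultra_setVsetC [set x | rle x i j] FF.
  by left.
right; apply: filterS3 Fi Fj nij => x xi xj /= nij.
by case: (rle_total xi xj).
Qed.

Definition ultralimit : rooted_perm :=
  RootedPerm dom0 dom_itv le_dom le_refl le_anti le_trans le_total.

(** Each entry of the table [code h] agrees with the limit on a set of [F]; as the table is finite,
    so does the whole table. *)
Lemma ultralimit_restr h : F [set x | restr h ultralimit = restr h x].
Proof.
pose E p x := code h ultralimit p = code h x p.
suff : F [set x | forall p, E p x].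
  by apply: filterS => x /= xE; apply/codeP/ffunP => p; rewrite xE.
apply: filter_forall => -[a b]; rewrite /E.
have [ab|ab] := in_ultra_setVsetC
    [set x | rle x (a%:Z - h%:Z) (b%:Z - h%:Z)] FF.
  apply: filterS (ab) => x /= xab.
  by rewrite !ffunE /=; apply: asbool_equiv_eq; split.
apply: filterS (ab) => x /= xab.
rewrite !ffunE /=; apply: asbool_equiv_eq; split=> // ab'.
by have [y []] := filter_ex (filterI ab ab').
Qed.

End ultralimit.

Lemma compact_local_space : compact [set: S].
Proof.
rewrite compact_ultra /= => F FF _; exists (ultralimit FF); split=> // A.
move=> /nbhs_localP[h hA]; apply: filterS (ultralimit_restr FF h) => x.
exact: hA.
Qed.

(* By compactness these are exactly the clopen sets. *)
Definition cylinder (A : set S) : Prop :=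
  exists h, forall x y, restr h x = restr h y -> A x -> A y.

Lemma cylinder_nbhs A x : cylinder A -> A x -> nbhs x A.
Proof. by move=> [h hA] Ax; apply/nbhs_localP; exists h => y /hA; apply. Qed.

Lemma cylinder_open A : cylinder A -> open A.
Proof. by rewrite openE => cA x Ax; exact: cylinder_nbhs. Qed.

Lemma cylinderC A : cylinder A -> cylinder (~` A).
Proof. by move=> [h hA]; exists h => x y /esym xy nAx /(hA _ _ xy). Qed.

Lemma cylinder0 : cylinder set0.
Proof. by exists 0%N. Qed.

Lemma cylinderU A B : cylinder A -> cylinder B -> cylinder (A `|` B).
Proof.
move=> [h hA] [k kB]; exists (maxn h k) => x y xy.
case=> [Ax|Bx]; [left; apply: hA Ax|right; apply: kB Bx].
  by apply: restr_eq_le xy; rewrite leq_maxl.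
by apply: restr_eq_le xy; rewrite leq_maxr.
Qed.

Lemma cylinder_code h c : cylinder [set x | code h x = c].
Proof. by exists h => x y /codeP /= ->. Qed.

(** Compactness in its near-covering form: every point has a neighbourhood on which, for all large
    [n], membership in [A] implies membership in the first [n] sets. *)
Lemma cylinder_cover A (F : (set S)^nat) : cylinder A ->
  (forall n, cylinder (F n)) -> A `<=` \bigcup_n F n ->
  exists n, A `<=` \big[setU/set0]_(i < n) F i.
Proof.
move=> cA cF AF.
have /compact_near_coveringP/near_covering_withinP := compact_local_space.
move=> /(_ nat \oo (fun n x => A x -> (\big[setU/set0]_(i < n) F i) x)).
case=> [x _|n _ /(_ n (leqnn n)) An]; last first.
  by exists n => x Ax; exact: An.
have [/AF[i _ Fix]|nAx] := pselect (A x); last first.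
  (* Off [A] the implication is vacuous, on a neighbourhood since the complement is a cylinder
     too. *)
  exists (~` A, setT) => /=.
    by split; [apply: cylinder_nbhs => //; exact: cylinderC|exact: filterT].
  by move=> -[y n] /= [nAy _] _ Ay.
exists (F i, [set n | (i < n)%N]) => /=.
  by split; [exact: cylinder_nbhs|exists i.+1].
move=> -[y n] /= [Fiy ni] _ _; rewrite -bigcup_mkord.
by exists i.
Qed.

(** The set of index [h] collects the points whose class of agreement up to [h] lies in [U]. Hence
    cylinders generate the Borel sets. *)
Lemma open_cylinders (U : set S) : open U ->
  exists2 F : (set S)^nat, (forall n, cylinder (F n)) & U = \bigcup_n F n.
Proof.
rewrite openE => oU.
exists (fun h => [set x | forall y, restr h x = restr h y -> U y]) => [h|].
  by exists h => x y xy Ux z yz; apply: Ux; rewrite xy.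
apply/seteqP; split=> [x /oU/nbhs_localP[h hU]|x [h _]]; first by exists h.
exact.
Qed.

Lemma local_uniform_continuity (f : S -> R) e : continuous f -> 0 < e ->
  exists h, forall x y, restr h x = restr h y -> `|f x - f y| <= e.
Proof.
move=> cf e0; have e20 : 0 < e / 2 by rewrite divr_gt0.
have /compact_near_coveringP := compact_local_space.
move=> /(_ nat \oo (fun h x => forall y, restr h x = restr h y ->
  `|f x - f y| <= e)).
case=> [x _|h _ /(_ h (leqnn h)) fh]; last by exists h => x y; exact: fh.
have /cvgr_dist_le/(_ _ e20)/nbhs_localP[h hf] : f y @[y --> x] --> f x.
  exact: cf.
exists ([set y | restr h x = restr h y], [set k | (h <= k)%N]) => /=.
  by split; [apply/nbhs_localP; exists h|exists h].
move=> -[y k] /= [xy hk] z yz.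
have xz : restr h x = restr h z by rewrite xy (restr_eq_le hk yz).
(* Both [y] and [z] agree with [x] up to [h], so their images are within [e / 2] of [f x]. *)
have := lerD (hf _ xy) (hf _ xz); rewrite -splitr.
apply: le_trans; rewrite (distrC (f x) (f y)) -[f y - f z](subrKA (f x)).
exact: ler_normD.
Qed.

End topology.

(** * Densities of cylinders *)

Lemma occurs_at_eq k (pi pi' : 'S_k.+1) s x :
  occurs_at pi s x -> occurs_at pi' s x -> pi = pi'.
Proof.
move=> o o'; apply: perm_eq_lt => a b; rewrite !ltnNge; congr (~~ _).
by apply/idP/idP => [/o/o'|/o'/o].
Qed.

(** Provides a canonical rooted permutation showing [pi], on which a cylinder can be tested. *)
Lemma occurs_at_self k (pi : 'S_k.+1) (s : 'I_k.+1) :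
  occurs_at pi s (finite_rooted pi s).
Proof.
apply/occurs_at_finite; first by rewrite -ltnS.
exists 0%N => //; split=> // a b a' b' a'E b'E.
have -> : a' = a by apply: val_inj; rewrite /= a'E.
by have -> : b' = b by apply: val_inj; rewrite /= b'E.
Qed.

(** A window of size 2h+1 with the root in its middle is all of [-h, h], so its pattern fixes every
    entry of [code h]. *)
Lemma occurs_at_restr h (pi : 'S_h.*2.+1) x y :
  occurs_at pi h x -> occurs_at pi h y -> restr h x = restr h y.
Proof.
move=> ox oy; apply/codeP/ffunP => -[a b]; rewrite !ffunE /=.
by apply: asbool_equiv_eq; rewrite ox oy.
Qed.

Lemma occurs_at_ex h n (sigma : 'S_n) (i : 'I_n) :
  (h <= i)%N -> (i + h < n)%N ->
  exists pi : 'S_h.*2.+1, occurs_at pi h (finite_rooted sigma i).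
Proof.
move=> hi ihn; pose I := [set j : 'I_n | (i - h <= j < i - h + h.*2.+1)%N]%SET.
have mkn : (i - h + h.*2.+1 <= n)%N by lia.
have IE (j : 'I_n) : (j \in I) = (i - h <= j < i - h + h.*2.+1)%N.
  by rewrite inE.
have [pi piE] : exists pi : 'S_h.*2.+1,
    existT (fun m : nat => 'S_m) #|I| (pat I sigma) = existT _ h.*2.+1 pi.
  (* Eliminating the equation on the cardinality transports the pattern to size 2h+1. *)
  by case: _ / (card_interval mkn IE); exists (pat I sigma).
exists pi; apply/occurs_at_finite; first by lia.
by exists (i - h)%N; [exact/(pat_intervalP _ _ mkn IE)|lia].
Qed.

Lemma occurs_at_inner h n (sigma : 'S_n) (i : 'I_n) (pi : 'S_h.*2.+1) :
  occurs_at pi h (finite_rooted sigma i) -> (h <= i)%N && (i + h < n)%N.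
Proof.
move=> /occurs_at_finite[|m [mkn _]]; first by lia.
by move=> ->; lia.
Qed.

Definition root_count n (sigma : 'S_n) (A : set rooted_perm) : nat :=
  #|[set i : 'I_n | `[< A (finite_rooted sigma i) >]]%SET|.

(** The inner roots form an interval of length [n - h.*2]; if [n < h.*2] the bound is trivial. *)
Lemma card_outer h n :
  (#|[set i : 'I_n | ~~ ((h <= i)%N && (i + h < n)%N)]%SET| <= h.*2)%N.
Proof.
have [hn|hn] := leqP h.*2 n; last first.
  by apply: leq_trans (max_card _) _; rewrite card_ord; lia.
rewrite -(leq_add2l (n - h.*2)) subnK// -[X in (_ <= X)%N]card_ord.
have IE (j : 'I_n) : (j \in [set i : 'I_n | (h <= i)%N && (i + h < n)%N]%SET)
    = (h <= j < h + (n - h.*2))%N by rewrite inE; lia.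
have hn' : (h + (n - h.*2) <= n)%N by lia.
rewrite -[X in (X + _ <= _)%N](card_interval hn' IE).
rewrite -[X in (_ <= X)%N](cardsC
  [set i : 'I_n | (h <= i)%N && (i + h < n)%N]%SET).
rewrite leq_add2l subset_leq_card//; apply/fintype.subsetP => i.
by rewrite !inE.
Qed.

(* [b] counts the roots at distance less than [h] from an end. *)
Lemma root_count_c_occ h (A : set rooted_perm) :
  (forall x y, restr h x = restr h y -> A x -> A y) ->
  forall n (sigma : 'S_n), exists2 b : nat, (b <= h.*2)%N &
  root_count sigma A = (\sum_(pi : 'S_h.*2.+1 |
    `[< A (finite_rooted pi (inord h)) >]) c_occ pi sigma + b)%N.
Proof.
move=> hA n sigma.
pose inner := [set i : 'I_n | (h <= i)%N && (i + h < n)%N]%SET.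
pose B := [set i : 'I_n | `[< A (finite_rooted sigma i) >]]%SET.
have inordh : (inord h : 'I_h.*2.+1) = h :> nat by rewrite inordK//; lia.
have Aself (pi : 'S_h.*2.+1) x : occurs_at pi h x ->
    A (finite_rooted pi (inord h)) <-> A x.
  move=> ox; have := @occurs_at_self _ pi (inord h); rewrite inordh => opi.
  by split; apply: hA; exact: occurs_at_restr.
exists #|B :\: inner|.
  apply: leq_trans (card_outer h n); apply/subset_leq_card/fintype.subsetP => i.
  by rewrite !inE => /andP[].
rewrite /root_count -/B -(cardsID inner B); congr addn.
have /choice[f fP] : forall i : 'I_n, exists pi : 'S_h.*2.+1,
    i \in inner -> occurs_at pi h (finite_rooted sigma i).
  (* Outside [inner] the value of [f] is arbitrary. *)
  move=> i; have [|nin] := boolP (i \in inner); last by exists 1%g.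
  rewrite inE => /andP[hi ihn].
  by have [pi] := occurs_at_ex sigma hi ihn; exists pi.
(* The inner roots in [A] are sorted by the pattern around them; each class is then counted by
   [c_occE] with offset [h]. *)
rewrite -sum1_card (partition_big f
  (fun pi => `[< A (finite_rooted pi (inord h)) >]))/=; last first.
  move=> i; rewrite inE [X in X && _]inE => /andP[/asboolP Ai iin].
  exact/asboolP/(Aself _ _ (fP i iin)).
apply: eq_bigr => pi /asboolP Api; rewrite (@c_occE _ _ _ _ h); last by lia.
rewrite -sum1_card; apply: eq_bigl => i; rewrite !inE.
apply/andP/asboolP => [[/andP[Ai iin] /eqP <-]|oi].
  by apply: fP; rewrite inE.
have iin := occurs_at_inner oi; split.
  by rewrite iin andbT; apply/asboolP/(Aself _ _ oi).
by apply/eqP; apply: occurs_at_eq oi; apply: fP; rewrite inE.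
Qed.

Section density.
Variables (R : realType) (sigma : forall n : nat, 'S_n.+1).

Definition root_density (A : set rooted_perm) (n : nat) : R :=
  (root_count (sigma n) A)%:R / n.+1%:R.

(** The density is a finite sum of pattern densities plus a boundary term, squeezed between 0 and
    2h/(n+1). *)
Lemma is_cvg_root_density (A : set rooted_perm) :
  (forall k (pi : 'S_k.+1), cvg (c_occ_prop R pi (sigma n) @[n --> \oo])) ->
  cylinder (A : set (local_space R)) -> cvg (root_density A n @[n --> \oo]).
Proof.
move=> cv [h hA].
have /choice[b bP] : forall n, exists b : nat, (b <= h.*2)%N /\
    root_count (sigma n) A = (\sum_(pi : 'S_h.*2.+1 |
    `[< A (finite_rooted pi (inord h)) >]) c_occ pi (sigma n) + b)%N.
  by move=> n; have [b bh E] := root_count_c_occ hA (sigma n); exists b.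
have -> : root_density A = \sum_(pi : 'S_h.*2.+1 |
    `[< A (finite_rooted pi (inord h)) >]) (fun n => c_occ_prop R pi (sigma n))
    + (fun n => (b n)%:R / n.+1%:R).
  apply/funext => n; rewrite /root_density (bP n).2 fct_sumE natrD mulrDl.
  by rewrite natr_sum mulr_suml.
apply: is_cvgD.
  elim/big_ind : _ => [|u v cu cv'|pi _]; [exact: is_cvg_cst|exact: is_cvgD|].
  exact: cv.
apply: (@cvgP _ _ 0); apply: (@squeeze_cvgr _ _ _ _ (fun=> 0)
  (fun n => (h.*2)%:R * n.+1%:R^-1)).
- apply: nearW => n; rewrite divr_ge0//= ler_wpM2r// ler_nat.
  by have [] := bP n.
- exact: cvg_cst.
- by rewrite -[X in _ --> X](mulr0 (h.*2)%:R); apply: cvgM;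
    [exact: cvg_cst|exact: cvg_harmonic].
Qed.

End density.

(** * Expectations of continuous functions *)

Lemma uniform_ordE (R : realType) n (A : set 'I_n.+1) :
  uniform_ord R n A = (#|[set i : 'I_n.+1 | `[< A i >]]%SET|%:R / n.+1%:R)%:E.
Proof.
set P := finset _.
have cardA : (A #= `I_#|P|)%card.
  have -> : A = range (@enum_val _ (mem P)).
    apply/seteqP; split=> [i Ai|_ [j _ <-]].
      have iP : i \in P by rewrite inE; exact/asboolP.
      by exists (enum_rank_in iP i) => //; rewrite enum_rankK_in.
    by have := enum_valP j; rewrite inE => /asboolP.
  apply: card_eq_trans (inj_card_eq _) _.
    by move=> *; exact: enum_val_inj.
  by rewrite card_eq_sym; exact: card_II.
rewrite /uniform_ord /mscale /= /counting asboolT; last by exists #|P|.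
by rewrite (card_fset_set cardA) -EFinM mulrC.
Qed.

Lemma continuous_borel_measurable (R : realType) (T : ptopologicalType)
  (f : T -> R) : continuous f -> measurable_fun setT (f : borel T -> R).
Proof.
move=> /continuousP cf; apply: (measurability _ (RGenOpens.measurableE R)).
move=> _ [_ [a [b ->] <-]]; rewrite setTI; apply: sub_sigma_algebra.
exact/cf/interval_open.
Qed.

Lemma cylinder_measurable (R : realType) (A : set (local_space R)) :
  cylinder A -> measurable (A : set (borel (local_space R))).
Proof. by move=> /cylinder_open; exact: sub_sigma_algebra. Qed.

Lemma cylinder_indic_continuous (R : realType) (A : set (local_space R)) :
  cylinder A -> continuous (\1_A : local_space R -> R).
Proof.
move=> [h hA] x.
suff : nbhs x [set y | \1_A y = \1_A x :> R].
  by move=> xA; apply: (@cvg_near_cst _ _ _ _ (nbhs x)).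
apply/nbhs_localP; exists h => y xy /=.
rewrite !indicE; congr (_%:R); congr (nat_of_bool _).
by apply/idP/idP => /set_mem zA; apply/mem_set; move: zA; apply: hA.
Qed.

Section expectation_approximation.
Context (R : realType) d (Omega : measurableType d) (P : probability Omega R).
Variable X : {RV P >-> borel (local_space R)}.
Local Notation S := (local_space R).

Lemma bounded_Lfun1 (Y : Omega -> R) M : measurable_fun setT Y ->
  (forall w, `|Y w| <= M) -> Y \in Lfun P 1.
Proof.
move=> mY YM; apply/Lfun1_integrable.
apply: measurable_bounded_integrable => //.
  by rewrite (le_lt_trans (probability_le1 _ _)) ?ltry.
exists M; split; first exact: num_real.
by move=> x Mx w _; exact: le_trans (YM w) (ltW Mx).
Qed.

Lemma cylinder_preimage_measurable (A : set S) :
  cylinder A -> measurable (X @^-1` A).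
Proof. by move=> cA; apply: measurable_funPTI; exact: cylinder_measurable. Qed.

Definition cylinder_prob (A : set S) : R := fine (P (X @^-1` A)).

Lemma cylinder_probE A : cylinder A -> (cylinder_prob A)%:E = P (X @^-1` A).
Proof.
move=> cA; rewrite fineK// fin_num_measure//.
exact: cylinder_preimage_measurable.
Qed.

(** The integral of the step function that replaces [f] on each class by its value at a chosen
    point. An empty class takes the value at [point], harmless since a probability gives it mass
    0. *)
Definition code_sum (f : S -> R) h (q : set S -> R) : R :=
  \sum_c f (xget (point : S) [set x : S | code h x = c]) *
    q [set x : S | code h x = c].

(** The step function [G] is within [e] of [f \o X] pointwise, and integrating against total mass 1
    keeps the bound. *)
Lemma expectation_code_sum (f : S -> R) h e :
    continuous f -> bounded_fun f ->
    (forall x y, restr h x = restr h y -> `|f x - f y| <= e) ->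
  'E_P[f \o X]%E \is a fin_num /\
  `|fine 'E_P[f \o X]%E - code_sum f h cylinder_prob| <= e.
Proof.
move=> cf [M0 [_ fM0]] fe.
(* Boundedness only provides bounds strictly above [M0]. *)
pose M := M0 + 1.
have fM x : `|f x| <= M by apply: fM0 => //; rewrite ltrDl.
have Lf : f \o X \in Lfun P 1.
  apply: (@bounded_Lfun1 _ M) => [|w]; last exact: fM.
  by apply: measurableT_comp => //; exact: continuous_borel_measurable.
pose A c : set S := [set x : S | code h x = c].
pose v c := f (xget (point : S) (A c)).
pose g c : Omega -> R := fun w => v c * \1_(X @^-1` A c) w.
have mA c : measurable (X @^-1` A c).
  by apply: cylinder_preimage_measurable; exact: cylinder_code.
have L1 c : (\1_(X @^-1` A c) : Omega -> R) \in Lfun P 1.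
  apply: (@bounded_Lfun1 _ 1) => // w.
  by rewrite indicE; case: (_ \in _); rewrite ?normr1// normr0.
have gE c : g c = v c \o* \1_(X @^-1` A c) by
  apply/funext => w; rewrite /g /= mulrC.
have Lg c : g c \in Lfun P 1.
  rewrite gE.
  apply: (@bounded_Lfun1 _ `|v c|) => [|w].
    by apply: measurable_funM => //; exact: measurable_indic.
  rewrite normrM indicE; case: (_ \in _); rewrite ?normr1 ?mul1r//.
  by rewrite normr0 mul0r.
have Egc c : 'E_P[g c]%E = (v c * cylinder_prob (A c))%:E.
  rewrite gE expectationZl// expectation_indic// EFinM cylinder_probE//.
  exact: cylinder_code.
pose G : Omega -> R := \sum_c g c.
have LG : G \in Lfun P 1 by apply: rpred_sum => c _.
have EG : 'E_P[G]%E = (code_sum f h cylinder_prob)%:E.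
  have -> : G = \sum_(Y <- [seq g c | c <- index_enum _]) Y.
    by rewrite big_map.
  rewrite expectation_sum => [|Y /mapP[c _ ->]//].
  by rewrite big_map -sumEFin; apply: eq_bigr => c _; exact: Egc.
(* Exactly one class contains [X w], so a single summand survives. *)
have GE w : G w = v (code h (X w)).
  rewrite /G fct_sumE (bigD1 (code h (X w)))//= [X in _ + X]big1 ?addr0.
    by rewrite /g indicE mem_set ?mulr1.
  move=> c cX; rewrite /g indicE memNset ?mulr0// => /= /esym/eqP.
  by rewrite (negbTE cX).
have fg w : `|f (X w) - G w| <= e.
  rewrite GE /v; apply: fe; apply/codeP.
  by case: xgetP => [y _ /= ->//|/(_ (X w)) []].
have fin := expectation_fin_num Lf; split => //.
have LB : (f \o X) \- G \in Lfun P 1 by exact: rpredB.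
have -> : fine 'E_P[f \o X]%E - code_sum f h cylinder_prob =
    fine 'E_P[(f \o X) \- G]%E.
  by rewrite expectationB// EG fineB.
suff : (`|'E_P[(f \o X) \- G]| <= e%:E)%E.
  by rewrite -(fineK (expectation_fin_num LB)) lee_fin.
have mB : measurable_fun setT (EFin \o ((f \o X) \- G)).
  by have /Lfun1_integrable/integrableP[] := LB.
rewrite unlock; apply: le_trans (le_abse_integral _ _ _) _ => //.
have e0 : 0 <= e by exact: le_trans (fg point).
apply: le_trans (integral_le_bound e%:E measurableT mB _ _) _ => //.
  by apply: aeW => w _; rewrite lee_fin; exact: fg.
rewrite [X in (_ * X)%E](_ : _ = 1%E) ?mule1//.
exact: probability_setT.
Qed.

End expectation_approximation.

(** * The limit law *)

Lemma code_sum_cvg (R : realType) (f : local_space R -> R) h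
    (q_ : nat -> set (local_space R) -> R) q :
  (forall A, cylinder A -> q_ n A @[n --> \oo] --> q A) ->
  code_sum f h (q_ n) @[n --> \oo] --> code_sum f h q.
Proof.
move=> qq.
rewrite (_ : (fun n => _) = \sum_(c : {ffun 'I_h.*2.+1 * 'I_h.*2.+1 -> bool})
  (fun n =>
    f (xget (point : local_space R) [set x : local_space R | code h x = c]) *
    q_ n [set x : local_space R | code h x = c])); last first.
  by apply/funext => n; rewrite fct_sumE.
apply: (big_ind2 (fun (u : nat -> R) (l : R) => u n @[n --> \oo] --> l)).
- exact: cvg_cst.
- by move=> u l v m; exact: cvgD.
move=> c _.
apply: cvgM; first exact: cvg_cst.
by apply: qq; exact: cylinder_code.
Qed.

(** Replacing [f] by its code sum costs at most [e / 3] under every law, uniformly in [n], and code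
    sums converge because they are finite. *)
Lemma cvg_in_distribution_cylinder (R : realType)
    (d_ : nat -> measure_display) (Omega_ : forall n, measurableType (d_ n))
    (P_ : forall n, probability (Omega_ n) R)
    (X_ : forall n, {RV (P_ n) >-> borel (local_space R)})
    (d : measure_display) (Omega : measurableType d) (P : probability Omega R)
    (X : {RV P >-> borel (local_space R)}) :
  (forall A, cylinder A ->
    cylinder_prob (X_ n) A @[n --> \oo] --> cylinder_prob X A) ->
  cvg_in_distribution X_ X.
Proof.
move=> cq f cf bf.
have fE d' (Omega' : measurableType d') (P' : probability Omega' R)
    (X' : {RV P' >-> borel (local_space R)}) :
    'E_P'[f \o X']%E = (fine 'E_P'[f \o X']%E)%:E.
  have [h fh] := local_uniform_continuity cf ltr01.
  by rewrite fineK//; have [] := expectation_code_sum X' cf bf fh.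
rewrite fE (_ : (fun n => _) =
  (fun n => (fine 'E_(P_ n)[f \o X_ n]%E)%:E)); last first.
  by apply/funext => n; exact: fE.
apply: cvg_EFin; first by apply: nearW.
apply/cvgrPdist_le => e e0 /=.
have e30 : 0 < e / 3 by rewrite divr_gt0.
have [h fh] := local_uniform_continuity cf e30.
have /cvgrPdist_le/(_ _ e30) := @code_sum_cvg _ f h _ _ cq.
apply: filterS => n Sn.
have [_ En] := expectation_code_sum (X_ n) cf bf fh.
have [_ E] := expectation_code_sum X cf bf fh.
move: Sn En E.
set a := fine _; set b := fine _.
set s := code_sum _ _ _; set t := code_sum _ _ _.
rewrite !ler_norml => /andP[? ?] /andP[? ?] /andP[? ?]; apply/andP; split; lra.
Qed.

Section root_density.
Variables (R : realType) (sigma : forall n : nat, 'S_n.+1).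

Lemma root_density_prob (A : set (local_space R)) n :
  cylinder_prob (P := uniform_ord R n) (rooted_at R (sigma n)) A =
  root_density R sigma A n.
Proof.
have := uniform_ordE R (rooted_at R (sigma n) @^-1` A).
rewrite /cylinder_prob => E.
transitivity (fine (uniform_ord R n (rooted_at R (sigma n) @^-1` A))).
  by [].
by rewrite E.
Qed.

Lemma root_density_ge0 A n : 0 <= root_density R sigma A n.
Proof. by rewrite divr_ge0. Qed.

Lemma root_density0 n : root_density R sigma set0 n = 0.
Proof.
rewrite /root_density /root_count (_ : finset _ = finset.set0) ?cards0 ?mul0r//.
by apply/setP => i; rewrite !inE; apply/negbTE/asboolPn.
Qed.

Lemma root_densityT n : root_density R sigma setT n = 1.
Proof.
rewrite /root_density /root_count (_ : finset _ = finset.setT).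
  by rewrite cardsT card_ord divff.
by apply/setP => i; rewrite !inE; exact/asboolP.
Qed.

Lemma root_densityU A B n : A `&` B = set0 ->
  root_density R sigma (A `|` B) n =
  root_density R sigma A n + root_density R sigma B n.
Proof.
move=> AB; rewrite /root_density -mulrDl -natrD; congr (_%:R / _).
rewrite /root_count -cardsUI (_ : (_ :&: _)%SET = finset.set0).
  rewrite cards0 addn0; apply: eq_card => i; rewrite !inE.
  by apply/asboolP/orP => -[] H; [left|right|left|right]; apply/asboolP.
apply/setP => i; rewrite !inE.
apply/negbTE/negP => /andP[/asboolP Ai /asboolP Bi].
have : (A `&` B) (finite_rooted (sigma n) i) by [].
by rewrite AB.
Qed.

End root_density.

(** A copy of the space whose measurable sets are the algebra of cylinders, the domain of the
    premeasure. *)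
Definition cylinder_space (R : realType) : Type := local_space R.

HB.instance Definition _ (R : realType) :=
  Pointed.copy (cylinder_space R) (local_space R).
HB.instance Definition _ (R : realType) :=
  @isAlgebraOfSets.Build default_measure_display (cylinder_space R)
    (@cylinder R) (@cylinder0 R) (@cylinderU R) (@cylinderC R).

Section limit_law.
Variables (R : realType) (sigma : forall n : nat, 'S_n.+1).
Variable cv : forall A : set (local_space R), cylinder A ->
  cvg (root_density R sigma A n @[n --> \oo]).

(* The argument [cv] only lets the measure structure be inferred. *)
Definition limit_density
    (_ : forall A : set (local_space R), cylinder A ->
      cvg (root_density R sigma A n @[n --> \oo]))
    (A : set (cylinder_space R)) : \bar R :=
  (limn (root_density R sigma A))%:E.

Let mu := limit_density cv.

Let mu_ge0 A : (0 <= mu A)%E.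
Proof.
rewrite lee_fin.
have [cA|ncA] := pselect (cvg (root_density R sigma A n @[n --> \oo])).
  by apply: limr_ge => //; apply: nearW => n; exact: root_density_ge0.
(* For a set of divergent density the limit takes the default value 0. *)
by rewrite dvgP.
Qed.

Let mu_additive : measure_function.semi_additive mu.
Proof.
apply/additive2P => [|A B cA cB AB].
  rewrite /mu /limit_density (_ : root_density R sigma set0 = fun=> 0).
    by rewrite lim_cst.
  by apply/funext => n; rewrite root_density0.
rewrite /mu /limit_density -EFinD -limD; [|exact: cv|exact: cv].
by congr (limn _)%:E; apply/funext => n; rewrite root_densityU.
Qed.

HB.instance Definition _ := isContent.Build _ _ _ (limit_density cv)
  mu_ge0 mu_additive.

(* By compactness a countable cover of a cylinder by cylinders has a finite
   subcover, so finite additivity is enough. *)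
Let mu_sigma_subadditive : measurable_subset_sigma_subadditive mu.
Proof.
move=> A F cF cA AF; have [n An] := @cylinder_cover R A F cA cF AF.
apply: (@le_trans _ _ (\sum_(0 <= i < n) mu (F i))%E); last first.
  by apply: nneseries_lim_ge => i _ _; exact: mu_ge0.
rewrite big_mkord.
pose mu' : {content set (cylinder_space R) -> \bar R} := limit_density cv.
have := @content_subadditive _ _ _ mu' A F n.
by apply => // k _; exact: cF.
Qed.

HB.instance Definition _ := Content_SigmaSubAdditive_isMeasure.Build _ _ _
  (limit_density cv) mu_sigma_subadditive.

Definition limit_law := measure_extension (limit_density cv).

HB.instance Definition _ := Measure.on limit_law.

Lemma limit_lawE A : cylinder A ->
  limit_law A = (limn (root_density R sigma A))%:E.
Proof.
by move=> cA; rewrite /limit_law /measure_extension measurable_mu_extE.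
Qed.

Lemma limit_law_setT : limit_law setT = 1%E.
Proof.
rewrite limit_lawE; last by exists 0%N.
rewrite (_ : root_density R sigma setT = fun=> 1) ?lim_cst//.
by apply/funext => n; rewrite root_densityT.
Qed.

HB.instance Definition _ :=
  @Measure_isProbability.Build _ _ R limit_law limit_law_setT.

End limit_law.

(** The identity, viewed as a random variable from the sigma-algebra generated by cylinders to the
    Borel one; its law will be the limit. *)
Definition of_cylinder_space (R : realType)
  (x : g_sigma_algebraType (@measurable _ (cylinder_space R))) :
  borel (local_space R) := x.

Lemma measurable_of_cylinder_space (R : realType) :
  measurable_fun setT (@of_cylinder_space R).
Proof.
apply: (measurability (@open (local_space R) :
  set (set (borel (local_space R)))) erefl) => _ [U oU <-].
rewrite setTI; have [F cF ->] := open_cylinders oU.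
by apply: bigcup_measurable => n _; apply: sub_sigma_algebra; exact: cF.
Qed.

HB.instance Definition _ (R : realType) := isMeasurableFun.Build _ _ _ _
  (@of_cylinder_space R) (@measurable_of_cylinder_space R).

(** * The equivalence *)

Lemma cylinder_occurs_at (R : realType) k (pi : 'S_k.+1) s :
  cylinder (occurs_at pi s : set (local_space R)).
Proof.
(* Positions in the window lie between [- s] and [k - s] relative to the root. *)
exists (k + s)%N => x y xy ox a b; rewrite -ox.
have ord_bound (c : 'I_k.+1) :
    - (k + s)%:Z <= c%:Z - s%:Z <= (k + s)%:Z by have := ltn_ord c; lia.
by rewrite (rle_restr x (ord_bound a) (ord_bound b)) xy -rle_restr.
Qed.

Lemma expectation_cylinder (R : realType) d (Omega : measurableType d)
    (P : probability Omega R) (X : {RV P >-> borel (local_space R)}) A :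
  cylinder A ->
  ('E_P[(\1_A : local_space R -> R) \o X] = (cylinder_prob X A)%:E)%E.
Proof.
move=> cA; have mA := cylinder_preimage_measurable X cA.
by rewrite cylinder_probE// -expectation_indic.
Qed.

Lemma root_density_occurs_at (R : realType) (sigma : forall n : nat, 'S_n.+1)
    k (pi : 'S_k.+1) n :
  root_density R sigma (occurs_at pi 0) n = c_occ_prop R pi (sigma n).
Proof. by rewrite /c_occ_prop (@c_occE _ _ _ _ 0). Qed.

Theorem theorem1p3 (R : realType) (sigma : forall n : nat, 'S_n.+1) :
  @BS_converges R id sigma <->
  exists Delta : forall k : nat, 'S_k.+1 -> R,
    (forall (k : nat) (pi : 'S_k.+1), 0 <= Delta k pi) /\
    (forall (k : nat) (pi : 'S_k.+1),
      (fun n : nat => c_occ_prop R pi (sigma n)) @ \oo --> Delta k pi).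
Proof.
split=> [[d [T [P [X XP]]]] | [Delta [_ cv]]].
  (* The root is the first position of the window; the indicator of this cylinder is a bounded
     continuous test function whose expectation is the density of [pi]. *)
  pose A k (pi : 'S_k.+1) : set (local_space R) := occurs_at pi 0.
  have cA k (pi : 'S_k.+1) : cylinder (A k pi) by exact: cylinder_occurs_at.
  exists (fun k pi => cylinder_prob X (A k pi)); split=> k pi.
    by rewrite fine_ge0.
  have bA : bounded_fun (\1_(A k pi) : local_space R -> R).
    exists 1; split; first exact: num_real.
    move=> M M1 x _; apply: le_trans (ltW M1).
    by rewrite indicE; case: (_ \in _); rewrite ?normr1// normr0.
  have := XP _ (cylinder_indic_continuous (cA k pi)) bA.
  rewrite expectation_cylinder// => /fine_cvg.
  apply: cvg_trans; apply: near_eq_cvg; apply: nearW => n /=.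
  rewrite (expectation_cylinder (P := uniform_ord R n)
    (rooted_at R (sigma n)) (cA k pi)) /=.
  by rewrite root_density_prob root_density_occurs_at.
have cvA (A : set (local_space R)) : cylinder A ->
    cvg (root_density R sigma A n @[n --> \oo]).
  by apply: is_cvg_root_density => k pi; apply: cvgP; exact: cv.
exists _, _, (limit_law cvA), (@of_cylinder_space R).
apply: cvg_in_distribution_cylinder => A cA.
rewrite [X in _ --> X](_ : _ = limn (root_density R sigma A)).
  under eq_fun do rewrite root_density_prob.
  exact: cvA.
by rewrite -[RHS]/(fine _%:E) -(limit_lawE cvA cA).
Qed.
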